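(* No non-constant flow space in $\Sigma$ is flow equivalent to a non-constant flow space in $\mathrm T$.
   Context: Let $F_2$ be free on $\{a,b\}$, and consider the positive endomorphisms $\sigma\colon a\mapsto aabaabab,\ b\mapsto aabab$; $\tau\colon a\mapsto aabaabab,\ b\mapsto abaab$; $\rho\colon a\mapsto ba,\ b\mapsto bba$. Let $W_2$ be an oriented wedge of two circles labelled $a$ and $b$, and for $\theta\in\{\sigma,\tau,\rho\}$ let $f_\theta\colon W_2\to W_2$ be a positive map (continuous surjection, wedge point to wedge point, orientation preserving on each circle, locally injective away from the wedge point) whose image of circle $x$ traverses, in order, the circles spelled by the word $\theta(x)$. Flow space: compact metrizable space of dimension one with continuous $\mathbb R$-action without fixed points; flow equivalence: homeomorphism mapping orbits to orbits preserving flow orientation. An expansion of $\mathbb X$ about a point: oriented wedges $X_i$, positive maps $f_i\colon X_{i+1}\to X_i$, projections $p_i\colon\mathbb X\to X_i$ (continuous surjections, locally injective and orientation preserving along orbits, sending the point to the wedge point) with $p_n=f_n\circ\cdots\circ f_{m-1}\circ p_m$ and $x\mapsto(p_i(x))_i$ a homeomorphism onto $\varprojlim(X_i,f_i)$. $\Sigma$ is the family of flow spaces admitting an expansion with every $X_i=W_2$ and every $f_i\in\{f_\sigma,f_\rho\}$; $\mathrm T$ likewise with $f_i\in\{f_\tau,f_\rho\}$. Such expansions are called admissible and are identified with the corresponding infinite sequence of symbols. Two sequences $(s_i)$, $(t_i)$ are tail equivalent if there are $k,l$ with $s_{k+j}=t_{l+j}$ for all $j\ge0$. A space in $\Sigma$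 or $\mathrm T$ is non-constant if it has an admissible expansion whose symbol sequence is not tail equivalent to a constant sequence. *)

(* Defs.v *)
From HB Require Import structures.
From mathcomp Require Import all_boot all_order all_algebra.
From mathcomp Require Import all_classical all_reals all_analysis.
From mathcomp Require Import Rstruct Rstruct_topology.
Set Implicit Arguments. Unset Strict Implicit. Unset Printing Implicit Defensive.
Import Order.TTheory GRing.Theory Num.Theory.
Local Open Scope classical_set_scope.
Local Open Scope ring_scope.

Notation RR := Rdefinitions.R.
Notation R2 := (RR * RR)%type.

Definition open_cover (T : topologicalType) (n : nat) (U : nat -> set T) :=
  (forall i, (i < n)%N -> open (U i)) /\ (forall x, exists i, (i < n)%N /\ U i x).

Definition refines (T : topologicalType) (m : nat) (V : nat -> set T)
    (n : nat) (U : nat -> set T) :=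
  forall j, (j < m)%N -> exists i, (i < n)%N /\ V j `<=` U i.

Definition order_le (T : topologicalType) (m : nat) (V : nat -> set T) (k : nat) :=
  forall x, (count (fun j => `[< V j x >]) (iota 0 m) <= k)%N.

Definition covdim_le (T : topologicalType) (d : nat) :=
  forall n (U : nat -> set T), open_cover n U ->
    exists m (V : nat -> set T), [/\ open_cover m V, refines m V n U & order_le m V d.+1].

Definition dim_one (T : topologicalType) := covdim_le T 1 /\ ~ covdim_le T 0.

Definition is_flow (T : topologicalType) (phi : RR -> T -> T) :=
  [/\ continuous (fun p : T * RR => phi p.2 p.1),
      (forall x, phi 0 x = x),
      (forall s t x, phi (s + t) x = phi s (phi t x)) &
      (forall x, exists t, phi t x <> x)].

(* compact metrizable (the topology of a Hausdorff pseudometric space),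
   one-dimensional, with a fixed-point-free continuous R-action *)
Definition flow_space (T : pseudoMetricType RR) (phi : RR -> T -> T) :=
  [/\ hausdorff_space T, compact [set: T], dim_one T & is_flow phi].

Definition flow_equiv (T1 T2 : pseudoMetricType RR)
    (phi1 : RR -> T1 -> T1) (phi2 : RR -> T2 -> T2) :=
  exists (h : T1 -> T2) (g : T2 -> T1),
    [/\ continuous h, continuous g, cancel h g, cancel g h &
     forall x, exists tau : RR -> RR,
       [/\ tau 0 = 0, continuous tau,
           (forall s t, s < t -> tau s < tau t),
           (forall y, exists t, tau t = y) &
           (forall t, h (phi1 t x) = phi2 (tau t) (h x))]].

(* letters: a = true, b = false. Circle a is centred at (-1,0), circle b at (1,0),
   both pass through the wedge point (0,0); e x t is the point at (oriented)
   parameter t (period 1) on circle x. *)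
Definition ltr_a := true.
Definition ltr_b := false.

Definition e (x : bool) (t : RR) : R2 :=
  if x then (cos (2 * pi * t) - 1, sin (2 * pi * t))
  else (1 - cos (2 * pi * t), sin (2 * pi * t)).

Definition wedge : R2 := (0, 0).

Definition W2 : set (R2) := [set p | exists x t, p = e x t].

Definition sigma_w (x : bool) : seq bool :=
  if x then [:: ltr_a; ltr_a; ltr_b; ltr_a; ltr_a; ltr_b; ltr_a; ltr_b]
  else [:: ltr_a; ltr_a; ltr_b; ltr_a; ltr_b].
Definition tau_w (x : bool) : seq bool :=
  if x then [:: ltr_a; ltr_a; ltr_b; ltr_a; ltr_a; ltr_b; ltr_a; ltr_b]
  else [:: ltr_a; ltr_b; ltr_a; ltr_a; ltr_b].
Definition rho_w (x : bool) : seq bool :=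
  if x then [:: ltr_b; ltr_a] else [:: ltr_b; ltr_b; ltr_a].

(* f : W_2 -> W_2 is a positive map whose image of circle x traverses, in order,
   the circles spelled by w x: the parameter interval [0,1] of circle x is cut at
   0 = tt 0 < tt 1 < ... < tt k = 1 and the j-th piece is mapped by an increasing
   homeomorphism onto the full circle (w x)_j, wedge point to wedge point. *)
Definition realizes (w : bool -> seq bool) (f : R2 -> R2) :=
  forall x, exists tt : nat -> RR,
    [/\ tt 0%N = 0, tt (size (w x)) = 1 &
     forall j, (j < size (w x))%N ->
       tt j < tt j.+1 /\
       exists g : RR -> RR,
         [/\ {within [set t | tt j <= t <= tt j.+1], continuous g},
             (forall s t, tt j <= s -> s < t -> t <= tt j.+1 -> g s < g t),
             g (tt j) = 0, g (tt j.+1) = 1 &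
             (forall t, tt j <= t <= tt j.+1 ->
                f (e x t) = e (nth ltr_a (w x) j) (g t))]].

(* a path in W_2 which is locally injective and orientation preserving:
   near every time t0 it arrives along some circle and leaves along some circle,
   with strictly increasing continuous parameter on each side *)
Definition pos_path (gam : RR -> R2) :=
  forall t0, exists eps, 0 < eps /\
    exists (x y : bool) (u v : RR -> RR),
      [/\ {within [set s | t0 - eps < s <= t0], continuous u},
          (forall s t, t0 - eps < s -> s < t -> t <= t0 -> u s < u t) &
          (forall s, t0 - eps < s <= t0 -> gam s = e x (u s))] /\
      [/\ {within [set s | t0 <= s < t0 + eps], continuous v},
          (forall s t, t0 <= s -> s < t -> t < t0 + eps -> v s < v t) &
          (forall s, t0 <= s < t0 + eps -> gam s = e y (v s))].

Definition invlim (fs : nat -> R2 -> R2) : set {ptws nat -> R2} :=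
  [set z | forall i, W2 (z i) /\ z i = fs i (z i.+1)].

Definition expansion (T : pseudoMetricType RR) (phi : RR -> T -> T)
    (fs : nat -> R2 -> R2) (p : nat -> T -> R2) :=
  [/\
      exists x0, forall i, p i x0 = wedge,
      (forall i, [/\ continuous (p i), range (p i) = W2 &
                     forall x, pos_path (fun t => p i (phi t x))]),
      (forall n m, (n <= m)%N -> forall x,
          p n x = foldr (fun i z => fs i z) (p m x) (iota n (m - n))) &
      let Phi := fun x : T => (fun i => p i x) : {ptws nat -> R2} in
      exists psi : {ptws nat -> R2} -> T,
        [/\ continuous Phi, (forall x, invlim fs (Phi x)),
            (forall x, psi (Phi x) = x),
            (forall z, invlim fs z -> Phi (psi z) = z) &
            {within invlim fs, continuous psi}]].

Definition admissible (fA fB : R2 -> R2)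
    (T : pseudoMetricType RR) (phi : RR -> T -> T) (s : nat -> bool) :=
  exists p, expansion phi (fun i => if s i then fA else fB) p.

Definition tail_equiv (s t : nat -> bool) :=
  exists k l, forall j, s (k + j)%N = t (l + j)%N.

Definition nonconstant (fA fB : R2 -> R2)
    (T : pseudoMetricType RR) (phi : RR -> T -> T) :=
  exists s, admissible fA fB phi s /\ ~ (exists c : bool, tail_equiv s (fun _ => c)).

(* Main.v *)
(** The number of classes in the first Alexander-Spanier cohomology set [H^1(X; S_3)]
    distinguishes the two families.  A cocycle is an arbitrary function [c x y] that is
    multiplicative on triples of nearby points; no continuity is required, and only the
    homeomorphism underlying the flow equivalence matters.  For an inverse limit of wedges
    [W_2] this set is the direct limit of the sets [Hom(F_2, S_3)] modulo conjugation, a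
    cocycle on [W_2] being classified by its holonomies along the two circles.
    The substitutions sigma and rho are automorphisms of [F_2], so they act injectively
    on [Hom(F_2, S_3)] modulo conjugation, and all its [N] classes survive in the limit for
    a space in [Sigma].  The substitution tau does not act injectively; in a non-constant
    space of [T] it occurs at arbitrarily high stages, so fewer than [N] classes
    survive. *)
Require Import Defs.
From mathcomp Require Import all_boot all_order all_algebra fingroup perm.
From mathcomp Require Import all_classical all_reals all_analysis.
From mathcomp Require Import Rstruct Rstruct_topology.
From mathcomp Require Import lra.
Set Implicit Arguments. Unset Strict Implicit. Unset Printing Implicit Defensive.
Import Order.TTheory GRing.Theory Num.Theory.
Import numFieldNormedType.Exports.
Local Open Scope classical_set_scope.
Local Open Scope ring_scope.

(** * Compactness *)

(** The pairs satisfying [B n] are decreasing nonempty sets in a compact product, so they cluster.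
    [B n] may fail to be closed, so the limit pair is only approximated by pairs satisfying it. *)
Lemma cluster_pair (T T' : topologicalType) (K : set T) (K' : set T')
    (B : nat -> T -> T' -> Prop) :
  compact K -> compact K' ->
  (forall n x x', B n.+1 x x' -> B n x x') ->
  (forall n, exists x x', [/\ K x, K' x' & B n x x']) ->
  exists x x', [/\ K x, K' x' & forall n U U', nbhs x U -> nbhs x' U' ->
    exists y y', [/\ K y, K' y', U y, U' y' & B n y y']].
Proof.
move=> cK cK' Bdec Bne.
have Bmono n m x x' : (n <= m)%N -> B m x x' -> B n x x'.
  by move=> /subnK <-; elim: (m - n)%N => // k IH /Bdec.
pose A n := [set z : T * T' | [/\ K z.1, K' z.2 & B n z.1 z.2]].
pose F := filter_from [set: nat] A.
have Ffil : Filter F.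
  apply: filter_from_filter; first by exists 0%N.
  move=> i j _ _; exists (maxn i j) => // z [Kz Kz' Bz].
  by split; split=> //; apply: Bmono Bz; rewrite ?leq_maxl ?leq_maxr.
have Fproper : ProperFilter F.
  apply: filter_from_proper => n _.
  by have [x [x' ?]] := Bne n; exists (x, x').
have FK : F (K `*` K') by exists 0%N => // z [].
have [[x x'] [[/= Kx Kx'] clx]] := compact_setX cK cK' Fproper FK.
exists x, x'; split=> // n U U' Ux Ux'.
have /clx : F (A n) by exists n.
move=> /(_ (U `*` U')) [].
  by exists (U, U').
by move=> [y y'] [[/= ? ? ?] [/= ? ?]]; exists y, y'.
Qed.

Definition cont_on (T : topologicalType) (M : pseudoMetricType RR) (K : set T)
    (f : T -> M) :=
  forall x, K x -> forall eps, 0 < eps -> nbhs x [set y | K y -> ball (f x) eps (f y)].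

Lemma continuous_cont_on (T : topologicalType) (M : pseudoMetricType RR)
    (K : set T) (f : T -> M) : continuous f -> cont_on K f.
Proof.
move=> fc x _ eps eps0; have /fc H : nbhs (f x) (ball (f x) eps) by exact: nbhsx_ballx.
have {}H : nbhs x (f @^-1` ball (f x) eps) by [].
by apply: filterS H => y b _; exact: b.
Qed.

Lemma within_cont_on (T : topologicalType) (M : pseudoMetricType RR)
    (K : set T) (f : T -> M) : {within K, continuous f} -> cont_on K f.
Proof.
move=> /subspace_continuousP fc x Kx eps eps0.
by have /(fc x Kx) : nbhs (f x) (ball (f x) eps) by exact: nbhsx_ballx.
Qed.

Lemma ball_eq (M : pseudoMetricType RR) (x y : M) : hausdorff_space M ->
  (forall eps, 0 < eps -> ball x eps y) -> x = y.
Proof. by move=> hM xy; apply: close_eq => //; rewrite ball_close => eps; apply: xy. Qed.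

(** Otherwise pairs with ever closer [P]-values and distant [Q]-values cluster at a pair in one
    fibre of [P]; [eta] absorbs the passage to the limit. With [P] the identity this is
    Heine-Cantor; with [Q] the identity it turns small fibres into uniform separation. *)
Lemma uniform_fibres (T : topologicalType) (M M' : pseudoMetricType RR)
    (K : set T) (P : T -> M) (Q : T -> M') (e eta : RR) :
  compact K -> cont_on K P -> cont_on K Q -> hausdorff_space M -> 0 < eta ->
  (forall x x', K x -> K x' -> P x = P x' -> ball (Q x) e (Q x')) ->
  exists2 d, 0 < d & forall x x', K x -> K x' -> ball (P x) d (P x') ->
    ball (Q x) (e + eta) (Q x').
Proof.
move=> cK cP cQ hM eta0 PQ; apply: contrapT => H.
pose B n x x' := ball (P x) n.+1%:R^-1 (P x') /\ ~ ball (Q x) (e + eta) (Q x').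
have Bdec n x x' : B n.+1 x x' -> B n x x'.
  move=> [b1 b2]; split=> //; apply: le_ball b1.
  by rewrite lef_pV2 ?posrE ?ltr0n// ler_nat.
have Bne n : exists x x', [/\ K x, K x' & B n x x'].
  apply: contrapT => Hn; apply: H; exists n.+1%:R^-1; first by rewrite invr_gt0 ltr0n.
  move=> x x' Kx Kx' Pxx'; apply: contrapT => nQ; apply: Hn.
  by exists x, x'.
have [x [x' [Kx Kx' clx]]] := cluster_pair cK cK Bdec Bne.
have Pxx' : P x = P x'.
  apply: ball_eq => // eps eps0.
  have e3 : 0 < eps / 3 by rewrite divr_gt0.
  have [n _ /(_ n (leqnn _)) nlt] : \forall n \near \oo, n.+1%:R^-1 < eps / 3 :> RR.
    by near=> n; near: n; exact: near_infty_natSinv_lt (PosNum e3).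
  have [y [y' [Ky Ky' Py Py' [b _]]]] := clx n _ _ (cP x Kx _ e3) (cP x' Kx' _ e3).
  have -> : eps = eps / 3 + eps / 3 + eps / 3 by lra.
  apply: ball_triangle (ball_sym (Py' Ky')).
  by apply: ball_triangle (Py Ky) (le_ball _ b); exact: ltW.
have e2 : 0 < eta / 2 by rewrite divr_gt0.
have [y [y' [Ky Ky' Qy Qy' [_]]]] := clx 0%N _ _ (cQ x Kx _ e2) (cQ x' Kx' _ e2).
apply; have -> : e + eta = eta / 2 + e + eta / 2 by lra.
apply: ball_triangle (Qy' Ky').
exact: ball_triangle (ball_sym (Qy Ky)) (PQ _ _ Kx Kx' Pxx').
Unshelve. all: by end_near.
Qed.

Lemma uniform_cont_on (M M' : pseudoMetricType RR) (K : set M) (Q : M -> M') (eta : RR) :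
  compact K -> cont_on K Q -> hausdorff_space M -> 0 < eta ->
  exists2 d, 0 < d & forall x x', K x -> K x' -> ball x d x' -> ball (Q x) eta (Q x').
Proof.
move=> cK cQ hM eta0; have e2 : 0 < eta / 2 by rewrite divr_gt0.
have cid : cont_on K (@idfun M) by apply: continuous_cont_on => x; exact: cvg_id.
have [|d d0 H] := @uniform_fibres _ _ _ K idfun Q (eta / 2) (eta / 2) cK cid cQ hM e2.
  by move=> x x' _ _ /= ->; exact: ballxx.
by exists d => // x x' Kx Kx' /H; rewrite -splitr; apply.
Qed.

(** * Cocycles on an interval *)

Definition cocycle (G : finGroupType) (M : pseudoMetricType RR) (K : set M)
    (c : M -> M -> G) :=
  exists2 d, 0 < d & forall x y z, K x -> K y -> K z ->
    ball x d y -> ball y d z -> ball x d z -> (c x y * c y z)%g = c x z.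

(** The value of [u] at the wedge point will be the element conjugating the holonomies, so [u] is an
    explicit argument. *)
Definition cohomologous (G : finGroupType) (M : pseudoMetricType RR) (K : set M)
    (c c' : M -> M -> G) (u : M -> G) :=
  exists2 d, 0 < d & forall x y, K x -> K y -> ball x d y ->
    c' x y = ((u x)^-1 * c x y * u y)%g.

Definition segm (a b : RR) : set RR := [set t : RR | a <= t <= b].

(** The function [v] is a primitive of [C]; when [v a = 1], its value [v b] is the holonomy along
    the interval. *)
Definition trivialized (G : finGroupType) (C : RR -> RR -> G) (a b : RR) (v : RR -> G) :=
  exists2 d, 0 < d & forall s t, a <= s <= b -> a <= t <= b -> `|s - t| < d ->
    C s t = ((v s)^-1 * v t)%g.

Lemma cocycle_id (G : finGroupType) (M : pseudoMetricType RR) (K : set M)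
    (c : M -> M -> G) : cocycle K c -> forall x, K x -> c x x = 1%g.
Proof.
move=> [d d0 cc] x Kx.
by apply: (mulIg (c x x)); rewrite mul1g; apply: cc => //; exact: ballxx.
Qed.

Lemma ballR (x d y : RR) : ball x d y = (`|x - y| < d) :> Prop.
Proof. by []. Qed.

Lemma exists_invn_lt (d : RR) : 0 < d -> exists n, n.+1%:R^-1 < d.
Proof.
move=> d0.
have [n _ /(_ n (leqnn _)) nlt] : \forall n \near \oo, n.+1%:R^-1 < d :> RR.
  by near=> n; near: n; exact: near_infty_natSinv_lt (PosNum d0).
by exists n.
Unshelve. all: by end_near.
Qed.

(** Equality is passed along the chain of points [k / n.+1], whose step is below [d]. *)
Lemma locally_constant_itv (G : Type) (z : RR -> G) (d : RR) : 0 < d ->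
  (forall s t, 0 <= s <= 1 -> 0 <= t <= 1 -> `|s - t| < d -> z s = z t) -> z 0 = z 1.
Proof.
move=> /exists_invn_lt [n nd] zc.
suff H k : (k <= n.+1)%N -> z 0 = z (k%:R / n.+1%:R).
  by rewrite (H n.+1) // divff // pnatr_eq0.
have I j : (j <= n.+1)%N -> 0 <= (j%:R / n.+1%:R : RR) <= 1.
  move=> jn; rewrite divr_ge0 ?ler0n //= ler_pdivrMr ?ltr0n // mul1r ler_nat //.
elim: k => [|k IH] kn; first by rewrite mul0r.
rewrite IH ?(ltnW kn) //; apply: zc; rewrite ?I ?(ltnW kn) //.
by rewrite distrC -mulrBl -natr1 addrAC subrr add0r mul1r ger0_norm.
Qed.

(** The quotient [w s * (v s)^-1] of two primitives is locally constant. *)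
Lemma trivialized_uniq (G : finGroupType) (C : RR -> RR -> G) (v w : RR -> G) :
  trivialized C 0 1 v -> trivialized C 0 1 w -> v 0 = w 0 -> v 1 = w 1.
Proof.
move=> [d d0 Cv] [d' d'0 Cw] vw0.
have dd0 : 0 < Num.min d d' by rewrite lt_min d0.
suff /(locally_constant_itv dd0) : forall s t, 0 <= s <= 1 -> 0 <= t <= 1 ->
    `|s - t| < Num.min d d' -> (w s * (v s)^-1 = w t * (v t)^-1)%g.
  by rewrite vw0 mulgV => /esym/eqP; rewrite -eq_mulgV1 => /eqP.
move=> s t sI tI; rewrite lt_min => /andP[sd sd'].
have := Cv s t sI tI sd; rewrite (Cw s t sI tI sd') => E.
by apply: (mulgI (w s)^-1%g); apply: (mulIg (v t)); rewrite !mulgA E mulVg mul1g mulgKV.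
Qed.

(** Two nearby points on opposite sides of [b] are both close to [b], so [C s t] factors as
    [C s b * C b t], and [v b = w b] cancels in the middle. *)
Lemma trivialized_glue (G : finGroupType) (C : RR -> RR -> G) (a b b' : RR)
    (v w : RR -> G) : a <= b <= b' -> cocycle (segm a b') C ->
  trivialized C a b v -> trivialized C b b' w -> v b = w b ->
  trivialized C a b' (fun t => if t <= b then v t else w t).
Proof.
move=> /andP[ab bb'] [d d0 Cc] [d1 d10 Cv] [d2 d20 Cw] vw.
exists (Num.min d (Num.min d1 d2)); first by rewrite !lt_min d0 d10.
move=> s t /andP[as_ sb] /andP[at_ tb]; rewrite !lt_min => /and3P[sd sd1 sd2].
have Cdec x y : a <= x <= b' -> a <= y <= b' -> (x <= b <= y) || (y <= b <= x) ->
    `|x - y| < d -> C x y = (C x b * C b y)%g.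
  move=> xI yI xby xyd; rewrite Cc ?ballR //=; first by apply/andP.
  - by case/orP: xby xyd => /andP[? ?]; rewrite !ltr_norml => /andP[? ?]; apply/andP; lra.
  - by case/orP: xby xyd => /andP[? ?]; rewrite !ltr_norml => /andP[? ?]; apply/andP; lra.
case: (leP s b) => sb_; case: (leP t b) => tb_.
- by apply: Cv; rewrite ?as_ ?at_.
- rewrite (Cdec s t) ?as_ ?at_ ?sb_ ?(ltW tb_) // (Cv s b) ?(Cw b t) ?as_ ?ab ?lexx ?bb' ?(ltW tb_) //.
  + by rewrite vw mulgA mulgK.
  + by move: sd2; rewrite !ltr_norml => /andP[? ?]; apply/andP; lra.
  + by move: sd1; rewrite !ltr_norml => /andP[? ?]; apply/andP; lra.
- rewrite (Cdec s t) ?as_ ?at_ ?tb_ ?(ltW sb_) ?orbT // (Cw s b) ?(Cv b t) ?at_ ?ab ?lexx ?bb' ?(ltW sb_) //.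
  + by rewrite vw mulgA mulgK.
  + by move: sd1; rewrite !ltr_norml => /andP[? ?]; apply/andP; lra.
  + by move: sd2; rewrite !ltr_norml => /andP[? ?]; apply/andP; lra.
- by apply: Cw; rewrite ?sb ?tb ?ltW.
Qed.

(** The interval is cut into pieces shorter than [d]. On a piece starting at [a] all points are
    mutually close, so [C a t] is a primitive there, and the pieces are glued by induction. *)
Lemma cocycle_itv_trivialized (G : finGroupType) (C : RR -> RR -> G) :
  cocycle (segm 0 1) C -> exists2 v, v 0 = 1%g & trivialized C 0 1 v.
Proof.
move=> CC; have [d d0 Cc] := CC; have [n nd] := exists_invn_lt d0.
have n0 : 0 < n.+1%:R^-1 :> RR by rewrite invr_gt0 ltr0n.
have C1 := cocycle_id CC.
pose p k : RR := k%:R * n.+1%:R^-1.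
have pS k : p k.+1 = p k + n.+1%:R^-1 by rewrite /p -natr1 mulrDl mul1r.
have p_ge0 k : 0 <= p k by rewrite divr_ge0 ?ler0n.
have p_le1 k : (k <= n.+1)%N -> p k <= 1.
  by move=> kn; rewrite ler_pdivrMr ?ltr0n // mul1r ler_nat.
suff H k : (k <= n.+1)%N -> exists2 v, v 0 = 1%g & trivialized C 0 (p k) v.
  by have [v ? ?] := H _ (leqnn _); exists v => //; rewrite -(@divff _ n.+1%:R) // pnatr_eq0.
elim: k => [_|k IH kn].
  exists (fun=> 1%g) => //; exists 1 => //; rewrite /p mul0r => s t sI tI _.
  have [-> ->] : s = 0 /\ t = 0 by lra.
  by rewrite C1 ?mulVg // /segm /= lexx ler01.
have [v v0 vC] := IH (ltnW kn).
have k1 := p_le1 _ kn; have k0 := p_ge0 k; rewrite pS in k1 *.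
move: (n.+1%:R^-1) (p k) nd n0 k0 k1 v0 vC => q a nd n0 k0 k1 v0 vC {p p_ge0 p_le1 pS IH kn}.
exists (fun t => if t <= a then v t else (v a * C a t)%g); first by rewrite k0.
apply: (@trivialized_glue _ C 0 a _ v (fun t => v a * C a t)%g) => //.
- by rewrite k0 lerDl ltW.
- have sub x : segm 0 (a + q) x -> segm 0 1 x.
    by move=> /andP[x0 /le_trans xp]; rewrite /segm /= x0 xp.
  by exists d => // x y z /sub xI /sub yI /sub zI; apply: Cc.
- exists d => // s t sI tI std; rewrite invMg -mulgA mulKg.
  apply: (mulgI (C a s)); rewrite mulKVg.
  have close x y : a <= x <= a + q -> a <= y <= a + q ->
      ball x d y.
    by move=> /andP[? ?] /andP[? ?]; rewrite ballR ltr_norml; apply/andP; lra.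
  have pkk : a <= a <= a + q by rewrite lexx lerDl ltW.
  have sub x : a <= x <= a + q -> segm 0 1 x.
    by move=> /andP[? ?]; apply/andP; lra.
  by apply: Cc; [exact: sub | exact: sub | exact: sub | exact: close | exact: close | exact: close].
- by rewrite C1 ?mulg1 //; apply/andP; lra.
Qed.

(** * The wedge of two circles *)

(** The difference formula gives [cos (2 * pi * (s - t)) = 1], so the half-angle sine vanishes; but
    it is positive for [0 < |s - t| < 1]. *)
Lemma cos_sin_turn_eq (s t : RR) : `|s - t| <= 1 ->
  cos (2 * pi * s) = cos (2 * pi * t) -> sin (2 * pi * s) = sin (2 * pi * t) ->
  s = t \/ `|s - t| = 1.
Proof.
move=> st1 cc ss.
have c1 : cos (2 * pi * (s - t)) = 1.
  by rewrite mulrBr cosB cc ss -!expr2 cos2Dsin2.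
have s0 : sin (pi * `|s - t|) = 0.
  apply/eqP; rewrite -sqrf_eq0; apply/eqP.
  have : cos (2 * pi * `|s - t|) = 1.
    by case: (ger0P (s - t)) => _ //; rewrite mulrN cosN.
  rewrite -mulrA mulr_natl cos_mulr2n => H.
  by have := cos2Dsin2 (pi * `|s - t|); lra.
have [->|st] := eqVneq s t; first by left.
right; apply: le_anti; rewrite st1 leNgt; apply/negP => lt1.
have : 0 < sin (pi * `|s - t|).
  by apply: sin_gt0_pi; rewrite mulr_gt0 ?pi_gt0 ?normr_gt0 ?subr_eq0 ?st //= -[ltRHS]mulr1 ltr_pM2l ?pi_gt0.
by rewrite s0 ltxx.
Qed.

Lemma e_int_shift (x : bool) (t : RR) (n : nat) : e x (t + n%:R) = e x t.
Proof.
have E : 2 * pi * (t + n%:R) = 2 * pi * t + (pi *+ 2) *+ n :> RR.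
  by rewrite mulrDr -(mulr_natr (pi *+ 2)) -(mulr_natl pi 2).
by rewrite /e E (periodicn (@cosD2pi _)) (periodicn (@sinD2pi _)).
Qed.

Lemma W2_param (p : R2) : W2 p -> exists x s, 0 <= s <= 1 /\ p = e x s.
Proof.
move=> [x [t ->]]; exists x.
have [n [tn nt]] : exists n : int, n%:~R <= t /\ t < n%:~R + 1.
  by exists (Num.floor t); rewrite floor_le_tmp -intrD1 floorD1_gt.
exists (t - n%:~R); split; first by apply/andP; lra.
case: n tn nt => n tn nt.
  by rewrite -(e_int_shift x (t - _) n) subrK.
by rewrite NegzE mulrNz opprK (e_int_shift x t n.+1).
Qed.

Lemma e0 (x : bool) : e x 0 = wedge.
Proof. by case: x; rewrite /e mulr0 cos0 sin0 subrr. Qed.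

Lemma e1 (x : bool) : e x 1 = wedge.
Proof. by rewrite -(e0 x) -(e_int_shift x 0 1) add0r. Qed.

Lemma W2_e (x : bool) (t : RR) : W2 (e x t).
Proof. by exists x, t. Qed.

Lemma W2_wedge : W2 wedge.
Proof. by rewrite -(e0 true); exact: W2_e. Qed.

Definition at_ends (s : RR) := s = 0 \/ s = 1.

Lemma e_at_ends x s : at_ends s -> e x s = wedge.
Proof. by case=> ->; rewrite ?e0 ?e1. Qed.

(** On one circle this is [cos_sin_turn_eq]. On different circles the first coordinates have
    opposite signs, so equality forces both cosines to be 1. *)
Lemma e_inj x y s t : 0 <= s <= 1 -> 0 <= t <= 1 -> e x s = e y t ->
  (x = y /\ s = t) \/ (at_ends s /\ at_ends t).
Proof.
move=> /andP[s0 s1] /andP[t0 t1].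
have cle (z : RR) := cos_le1 z.
have norm_le1 (a b : RR) : 0 <= a <= 1 -> 0 <= b <= 1 -> `|a - b| <= 1.
  by move=> /andP[? ?] /andP[? ?]; rewrite ler_norml; apply/andP; lra.
have ends (z : RR) : 0 <= z <= 1 -> cos (2 * pi * z) = 1 -> at_ends z.
  move=> zI c1.
  have sz : sin (2 * pi * z) = sin (2 * pi * 0).
    by rewrite mulr0 sin0; apply/eqP; rewrite -sqrf_eq0; have := cos2Dsin2 (2 * pi * z); rewrite c1; lra.
  case: (cos_sin_turn_eq (norm_le1 z 0 zI _) _ sz); rewrite ?lexx ?ler01 ?mulr0 ?cos0 //.
    by left.
  by rewrite subr0 ger0_norm; [right | case/andP: zI].
have eqs u : cos (2 * pi * s) = cos (2 * pi * t) -> sin (2 * pi * s) = sin (2 * pi * t) ->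
    (u = u :> bool /\ s = t) \/ (at_ends s /\ at_ends t).
  move=> cc ss; have st1 : `|s - t| <= 1 by apply: norm_le1; apply/andP.
  case: (cos_sin_turn_eq st1 cc ss) => [|d]; first by left.
  right; move: d; case: (ger0P (s - t)) => _ d.
    by split; [right | left]; lra.
  by split; [left | right]; lra.
case: x y => [] [] /= [X Y].
- by apply: eqs => //; lra.
- by have := cle (2 * pi * s); have := cle (2 * pi * t); right; split; apply: ends; try (apply/andP; split=> //); lra.
- by have := cle (2 * pi * s); have := cle (2 * pi * t); right; split; apply: ends; try (apply/andP; split=> //); lra.
- by apply: eqs => //; lra.
Qed.

(* Stated for an abstract [realType]: the lemmas on limits in normed modules do not
   infer their structures on the concrete real numbers. *)
Lemma continuous_turn (R : realType) :
  [/\ continuous (fun t : R => cos (2 * pi * t) - 1),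
      continuous (fun t : R => 1 - cos (2 * pi * t)) &
      continuous (fun t : R => sin (2 * pi * t))].
Proof.
have cm : continuous (fun t : R => 2 * pi * t).
  by move=> t; apply: cvgM; [exact: cvg_cst | exact: cvg_id].
have cc : continuous (fun t : R => cos (2 * pi * t)).
  by move=> t; apply: (continuous_comp (cm t)); exact: continuous_cos.
split=> t.
- by apply: cvgB; [exact: cc | exact: cvg_cst].
- by apply: cvgB; [exact: cvg_cst | exact: cc].
- by apply: (continuous_comp (cm t)); exact: continuous_sin.
Qed.

Lemma continuous_e x : continuous (e x).
Proof.
have [c1 c2 s] := continuous_turn RR.
by case: x => t; [exact: (cvg_pair (c1 t) (s t)) | exact: (cvg_pair (c2 t) (s t))].
Qed.

Lemma hausdorff_RR : hausdorff_space RR.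
Proof. exact: (@norm_hausdorff RR RR^o). Qed.

Lemma hausdorff_R2 : hausdorff_space (R2 : pseudoMetricType RR).
Proof. exact: (@norm_hausdorff RR (RR^o * RR^o)%type). Qed.

Lemma compact_segm (a b : RR) : compact (segm a b).
Proof.
suff -> : segm a b = `[a, b]%classic by exact: segment_compact.
by apply/seteqP; split=> t /=; rewrite /segm /= in_itv.
Qed.

(** * Holonomy *)

Lemma uniform_e (x : bool) (eps : RR) : 0 < eps ->
  exists2 d, 0 < d & forall s t, 0 <= s <= 1 -> 0 <= t <= 1 -> `|s - t| < d ->
    ball (e x s) eps (e x t).
Proof.
move=> eps0.
have ec : cont_on (segm 0 1) (e x) by apply: continuous_cont_on; exact: continuous_e.
have [d d0 H] := uniform_cont_on (@compact_segm 0 1) ec hausdorff_RR eps0.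
by exists d => // s t sI tI std; apply: H.
Qed.

Definition near_ends (eta s : RR) := s < eta \/ 1 - eta < s.

(** A quantitative form of [e_inj], by compactness: counterexamples at all scales cluster at
    parameters with equal image, and either alternative of [e_inj] there persists for nearby
    parameters. *)
Lemma wedge_close_at (eta : RR) (x y : bool) : 0 < eta ->
  exists2 d, 0 < d & forall s t, 0 <= s <= 1 -> 0 <= t <= 1 -> ball (e x s) d (e y t) ->
    (x = y /\ `|s - t| < eta) \/ (near_ends eta s /\ near_ends eta t).
Proof.
move=> eta0; pose P s t := (x = y /\ `|s - t| < eta) \/ (near_ends eta s /\ near_ends eta t).
apply: contrapT => H.
pose B n s t := ball (e x s) n.+1%:R^-1 (e y t) /\ ~ P s t.
have Bdec n s t : B n.+1 s t -> B n s t.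
  move=> [b1 b2]; split=> //; apply: le_ball b1.
  by rewrite lef_pV2 ?posrE ?ltr0n// ler_nat.
have Bne n : exists s t, [/\ segm 0 1 s, segm 0 1 t & B n s t].
  apply: contrapT => Hn; apply: H; exists n.+1%:R^-1; first by rewrite invr_gt0 ltr0n.
  move=> s t sI tI Pst; apply: contrapT => nQ; apply: Hn.
  by exists s, t.
have [s [t [sI tI cl]]] := cluster_pair (@compact_segm 0 1) (@compact_segm 0 1) Bdec Bne.
have est : e x s = e y t.
  apply: ball_eq; first exact: hausdorff_R2.
  move=> eps eps0; have e3 : 0 < eps / 3 by rewrite divr_gt0.
  have [n nd] := exists_invn_lt e3.
  have ex : nbhs s (e x @^-1` ball (e x s) (eps / 3)).
    by apply: (@continuous_e x s); exact: nbhsx_ballx.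
  have ey : nbhs t (e y @^-1` ball (e y t) (eps / 3)).
    by apply: (@continuous_e y t); exact: nbhsx_ballx.
  have [s' [t' [_ _ bs bt [b _]]]] := cl n _ _ ex ey.
  have -> : eps = eps / 3 + eps / 3 + eps / 3 by lra.
  apply: ball_triangle (ball_sym bt).
  by apply: ball_triangle bs (le_ball _ b); exact: ltW.
have e2 : 0 < eta / 2 by rewrite divr_gt0.
have [s' [t' [_ _ + + [_]]]] := cl 0%N _ _ (nbhsx_ballx s _ e2) (nbhsx_ballx t _ e2).
rewrite !ballR !ltr_norml => /andP[? ?] /andP[? ?]; apply; rewrite /P /near_ends.
have [[xy st]|[]] := e_inj sI tI est.
  by left; split=> //; rewrite ltr_norml; apply/andP; lra.
by move=> [] s_ [] t_; right; (split; [try (left; lra); try (right; lra)..]).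
Qed.

Lemma wedge_close (eta : RR) : 0 < eta ->
  exists2 d, 0 < d & forall x y s t, 0 <= s <= 1 -> 0 <= t <= 1 -> ball (e x s) d (e y t) ->
    (x = y /\ `|s - t| < eta) \/ (near_ends eta s /\ near_ends eta t).
Proof.
move=> eta0.
have [d1 d10 H1] := @wedge_close_at eta true true eta0.
have [d2 d20 H2] := @wedge_close_at eta true false eta0.
have [d3 d30 H3] := @wedge_close_at eta false true eta0.
have [d4 d40 H4] := @wedge_close_at eta false false eta0.
exists (Num.min (Num.min d1 d2) (Num.min d3 d4)); first by rewrite !lt_min d10 d20 d30.
have le1 (a b : RR) : Num.min a b <= a by rewrite ge_min lexx.
have le2 (a b : RR) : Num.min a b <= b by rewrite ge_min lexx orbT.
move=> [] [] s t sI tI b.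
- by apply: H1 => //; apply: le_ball b; exact: le_trans (le1 _ _) (le1 _ _).
- by apply: H2 => //; apply: le_ball b; exact: le_trans (le1 _ _) (le2 _ _).
- by apply: H3 => //; apply: le_ball b; exact: le_trans (le2 _ _) (le1 _ _).
- by apply: H4 => //; apply: le_ball b; exact: le_trans (le2 _ _) (le2 _ _).
Qed.

Definition unif_cont (M M' : pseudoMetricType RR) (K : set M) (F : M -> M') :=
  forall eps, 0 < eps -> exists2 d, 0 < d &
    forall x y, K x -> K y -> ball x d y -> ball (F x) eps (F y).

Lemma cocycle_pull (G : finGroupType) (M M' : pseudoMetricType RR) (K : set M)
    (K' : set M') (F : M -> M') (c : M' -> M' -> G) :
  (forall x, K x -> K' (F x)) -> unif_cont K F -> cocycle K' c ->
  cocycle K (fun x y => c (F x) (F y)).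
Proof.
move=> FK Fu [d d0 cc]; have [d' d'0 Fd] := Fu _ d0.
by exists d' => // x y z Kx Ky Kz b1 b2 b3; apply: cc; auto.
Qed.

Lemma cohomologous_pull (G : finGroupType) (M M' : pseudoMetricType RR) (K : set M)
    (K' : set M') (F : M -> M') (c c' : M' -> M' -> G) (u : M' -> G) :
  (forall x, K x -> K' (F x)) -> unif_cont K F -> cohomologous K' c c' u ->
  cohomologous K (fun x y => c (F x) (F y)) (fun x y => c' (F x) (F y)) (u \o F).
Proof.
move=> FK Fu [d d0 cc]; have [d' d'0 Fd] := Fu _ d0.
by exists d' => // x y Kx Ky b1; apply: cc; auto.
Qed.

(** Here [h] stands for the homomorphism from the free group with these values on the letters;
    [v 0 = 1] makes it unique by [trivialized_uniq]. *)
Definition holonomy (G : finGroupType) (c : R2 -> R2 -> G) (h : bool -> G) :=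
  forall x, exists v, [/\ v 0 = 1%g, v 1 = h x &
    trivialized (fun s t => c (e x s) (e x t)) 0 1 v].

Lemma cocycle_on_circle (G : finGroupType) (c : R2 -> R2 -> G) (x : bool) :
  cocycle W2 c -> cocycle (segm 0 1) (fun s t => c (e x s) (e x t)).
Proof.
apply: cocycle_pull; first by move=> s _; exact: W2_e.
by move=> eps /(uniform_e x)[d d0 H]; exists d.
Qed.

Lemma holonomy_exists (G : finGroupType) (c : R2 -> R2 -> G) :
  cocycle W2 c -> exists h, holonomy c h.
Proof.
move=> cc.
have ex x : exists v : RR -> G, v 0 = 1%g /\
    trivialized (fun s t => c (e x s) (e x t)) 0 1 v.
  by have [v ? ?] := cocycle_itv_trivialized (cocycle_on_circle x cc); exists v.
have [v vP] := choice ex.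
by exists (fun x => v x 1) => x; exists (v x); have [? ?] := vP x.
Qed.

(** Twisting a primitive of [c] by [u] gives a primitive of [c']. Both ends of a circle are the
    wedge point, so the twist there is conjugation by [u wedge]. *)
Lemma holonomy_cohomologous (G : finGroupType) (c c' : R2 -> R2 -> G) (u : R2 -> G)
    (h h' : bool -> G) :
  holonomy c h -> holonomy c' h' -> cohomologous W2 c c' u ->
  forall x, h' x = (h x ^ u wedge)%g.
Proof.
move=> hc hc' [d d0 cu] x.
have [v [v0 <- [dv dv0 vc]]] := hc x; have [w [w0 <- wc]] := hc' x.
have [d' d'0 ed] := uniform_e x d0.
have tc : trivialized (fun s t => c' (e x s) (e x t)) 0 1
    (fun t => (u wedge)^-1 * v t * u (e x t))%g.
  exists (Num.min dv d'); first by rewrite lt_min dv0.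
  move=> s t sI tI; rewrite lt_min => /andP[b1 b2].
  rewrite cu; [|exact: W2_e|exact: W2_e|exact: ed].
  by rewrite vc // !invMg invgK !mulgA mulgK.
have /= := trivialized_uniq wc tc; rewrite w0 v0 e0 e1 mulg1 mulVg => -> //.
by rewrite conjgE mulgA.
Qed.

Lemma W2_param_fun : exists par : R2 -> bool * RR, forall p, W2 p ->
  0 <= (par p).2 <= 1 /\ p = e (par p).1 (par p).2.
Proof.
have ex p : exists z : bool * RR, W2 p -> 0 <= z.2 <= 1 /\ p = e z.1 z.2.
  have [/W2_param[x [s ?]]|] := pselect (W2 p); first by exists (x, s).
  by exists (true, 0).
by have [par ?] := choice ex; exists par.
Qed.

Lemma near_ends_dist eta s : 0 <= s <= 1 -> near_ends eta s ->
  exists2 a, at_ends a & 0 <= a <= 1 /\ `|s - a| < eta.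
Proof.
move=> /andP[s0 s1] [H|H].
  by exists 0; [left | rewrite lexx ler01 subr0 ger0_norm].
exists 1; first by right.
by rewrite lexx ler01 ltr_norml; split=> //; apply/andP; lra.
Qed.

(** The cochain [u] is [v^-1 * g * w] for primitives [v] and [w] along the circles. Nearby points
    are compared along one circle or, when both are near ends, through the wedge point. *)
Lemma cohomologous_of_conj (G : finGroupType) (c c' : R2 -> R2 -> G) (h h' : bool -> G)
    (g : G) :
  cocycle W2 c -> cocycle W2 c' -> holonomy c h -> holonomy c' h' ->
  (forall x, h' x = (h x ^ g)%g) -> exists u, cohomologous W2 c c' u.
Proof.
move=> [dc dc0 cc] [dc' dc'0 cc'] /choice[v vP] /choice[w wP] hg.
have [par parP] := W2_param_fun.
pose u p := ((v (par p).1 (par p).2)^-1 * g * w (par p).1 (par p).2)%g.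
(* All four ends of the circles give the value [g], by conjugacy of the holonomies; the choice made
   by [par] at the wedge point is therefore harmless. *)
have uends x s : at_ends s -> ((v x s)^-1 * g * w x s = g)%g.
  have [v0 v1 _] := vP x; have [w0 w1 _] := wP x.
  case=> ->; rewrite ?v0 ?w0 ?invg1 ?mul1g ?mulg1 // v1 w1 hg conjgE.
  by rewrite -!mulgA mulKVg mulKg.
have uE x s : 0 <= s <= 1 -> u (e x s) = ((v x s)^-1 * g * w x s)%g.
  move=> sI; have [pI /esym pE] := parP _ (W2_e x s).
  rewrite /u; have [[-> ->] //|[H1 H2]] := e_inj pI sI pE.
  by rewrite !uends.
have vt x : exists2 d, 0 < d & forall s t, 0 <= s <= 1 -> 0 <= t <= 1 -> `|s - t| < d ->
    c' (e x s) (e x t) = ((u (e x s))^-1 * c (e x s) (e x t) * u (e x t))%g.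
  have [_ _ [d1 d10 vE]] := vP x; have [_ _ [d2 d20 wE]] := wP x.
  exists (Num.min d1 d2); first by rewrite lt_min d10.
  move=> s t sI tI; rewrite lt_min => /andP[b1 b2].
  by rewrite !uE // vE // wE // !invMg invgK !mulgA !mulgK mulgKV.
have [dt dt0 dtP] : exists2 d, 0 < d & forall x s t, 0 <= s <= 1 -> 0 <= t <= 1 ->
    `|s - t| < d ->
    c' (e x s) (e x t) = ((u (e x s))^-1 * c (e x s) (e x t) * u (e x t))%g.
  have [d1 d10 H1] := vt true; have [d2 d20 H2] := vt false.
  exists (Num.min d1 d2); first by rewrite lt_min d10.
  by move=> [] s t sI tI; rewrite lt_min => /andP[b1 b2]; [apply: H1 | apply: H2].
pose m := Num.min dc dc'; have m0 : 0 < m by rewrite lt_min dc0.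
have [de de0 deP] : exists2 d, 0 < d & forall x s t, 0 <= s <= 1 -> 0 <= t <= 1 ->
    `|s - t| < d -> ball (e x s) m (e x t).
  have [d1 d10 H1] := uniform_e true m0; have [d2 d20 H2] := uniform_e false m0.
  exists (Num.min d1 d2); first by rewrite lt_min d10.
  by move=> [] s t sI tI; rewrite lt_min => /andP[b1 b2]; [apply: H1 | apply: H2].
have eta0 : 0 < Num.min dt de by rewrite lt_min dt0.
have [d d0 dP] := wedge_close eta0.
exists u, (Num.min d m); first by rewrite lt_min d0.
move=> p q /W2_param[x [s [sI ->]]] /W2_param[y [t [tI ->]]] b.
have b1 : ball (e x s) d (e y t) by apply: le_ball b; rewrite ge_min lexx.
have b2 : ball (e x s) m (e y t) by apply: le_ball b; rewrite ge_min lexx orbT.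
have [[<-]|[/(near_ends_dist sI)[a aE [aI sa]] /(near_ends_dist tI)[a' a'E [a'I ta']]]] :=
  dP _ _ _ _ sI tI b1.
  by rewrite lt_min => /andP[? _]; exact: dtP.
move: sa ta'; rewrite !lt_min => /andP[sa sa'] /andP[ta ta'].
have bs : ball (e x s) m wedge by rewrite -(e_at_ends x aE); exact: deP.
have bt : ball wedge m (e y t).
  by rewrite -(e_at_ends y a'E); apply: ball_sym; exact: deP.
have split_c (k : R2 -> R2 -> G) dk : m <= dk ->
    (forall p q r, W2 p -> W2 q -> W2 r -> ball p dk q -> ball q dk r -> ball p dk r ->
      (k p q * k q r)%g = k p r) -> k (e x s) (e y t) = (k (e x s) wedge * k wedge (e y t))%g.
  move=> mdk ->//; [exact: W2_e|exact: W2_wedge|exact: W2_e|exact: le_ball bs|exact: le_ball bt|exact: le_ball b2].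
rewrite (split_c c dc) ?ge_min ?lexx // (split_c c' dc') ?ge_min ?lexx ?orbT //.
have -> : c' (e x s) wedge = ((u (e x s))^-1 * c (e x s) wedge * u wedge)%g.
  by rewrite -(e_at_ends x aE); exact: dtP.
have -> : c' wedge (e y t) = ((u wedge)^-1 * c wedge (e y t) * u (e y t))%g.
  by rewrite -(e_at_ends y a'E); apply: dtP => //; rewrite distrC.
by move: (u _) (u _) (u _) => a1 a2 a3; rewrite !mulgA mulgK.
Qed.

Definition word_prod (G : finGroupType) (h : bool -> G) (w : seq bool) : G :=
  (\prod_(i <- w) h i)%g.

(** The image of circle [x] runs through the letters of [w x] in turn. A primitive is extended over
    each piece by a left translate of the primitive of the next circle, so holonomies multiply in
    the order of the word. *)
Lemma holonomy_pull (G : finGroupType) (w : bool -> seq bool) (f : R2 -> R2)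
    (c : R2 -> R2 -> G) (h : bool -> G) :
  realizes w f -> (forall p, W2 p -> W2 (f p)) ->
  @unif_cont R2 R2 W2 f -> cocycle W2 c -> holonomy c h ->
  holonomy (fun p q => c (f p) (f q)) (fun x => word_prod h (w x)).
Proof.
move=> rf fW fu cc /choice[v vP] x; have [tt [tt0 tt1 ttP]] := rf x.
set n := size (w x) in tt1 ttP.
have Cc : cocycle (segm 0 1) (fun s t => c (f (e x s)) (f (e x t))).
  by apply: (@cocycle_on_circle _ (fun p q => c (f p) (f q))); exact: cocycle_pull cc.
have tt_le i j : (i <= j <= n)%N -> tt i <= tt j.
  move=> /andP[/subnKC <-]; elim: (j - i)%N => [|k IH]; first by rewrite addn0.
  rewrite addnS => kn; apply: le_trans (IH (ltnW kn)) _.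
  by have [/ltW] := ttP _ kn.
suff H j : (j <= n)%N -> exists V, [/\ V 0 = 1%g, V (tt j) = word_prod h (take j (w x)) &
    trivialized (fun s t => c (f (e x s)) (f (e x t))) 0 (tt j) V].
  have [V [V0 V1 VC]] := H n (leqnn _).
  by exists V; rewrite -tt1 -V0 V1 take_size.
elim: j => [_|j IH jn].
  exists (fun=> 1%g); rewrite take0 /word_prod big_nil; split=> //.
  exists 1 => // s t; rewrite tt0 => /le_anti <- /le_anti <- _.
  by rewrite mulVg; apply: (cocycle_id Cc); rewrite /segm /= lexx ler01.
have [V [V0 V1 VC]] := IH (ltnW jn).
have [ttj [g [gc gmono g0 g1 gE]]] := ttP _ jn.
set y := nth ltr_a (w x) j in gE.
have [vy0 vy1 [dv dv0 vyC]] := vP y.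
have tj0 : 0 <= tt j by rewrite -tt0; apply: tt_le => /=; exact: ltnW.
have tj1 : tt j.+1 <= 1 by rewrite -tt1; apply: tt_le; rewrite jn leqnn.
exists (fun t => if t <= tt j then V t else (V (tt j) * v y (g t))%g).
split; first by rewrite tj0.
- rewrite leNgt ttj /= g1 vy1 V1 (take_nth ltr_a) // /word_prod -cats1 big_cat /=.
  by rewrite big_seq1.
apply: (@trivialized_glue _ _ 0 (tt j) _ V (fun t => V (tt j) * v y (g t))%g) => //.
- by rewrite tj0 ltW.
- case: Cc => d d0 Cd; exists d => // s t r.
  have sub z : segm 0 (tt j.+1) z -> segm 0 1 z.
    by move=> /andP[z0 /le_trans zt]; rewrite /segm /= z0 zt.
  by move=> /sub sI /sub tI /sub rI; exact: Cd.
- have gc' := within_cont_on gc.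
  have [d d0 gd] := uniform_cont_on (@compact_segm (tt j) (tt j.+1)) gc' hausdorff_RR dv0.
  have gI s : tt j <= s <= tt j.+1 -> 0 <= g s <= 1.
    move=> /andP[]; rewrite !le_eqVlt => /orP[/eqP <- _|a]; first by rewrite g0 eqxx ltr01 orbT.
    move=> /orP[/eqP ->|b]; first by rewrite g1 eqxx ltr01 orbT.
    have -> : 0 < g s by rewrite -g0; apply: gmono => //; exact: ltW.
    have -> : g s < 1 by rewrite -g1; apply: gmono => //; exact: ltW.
    by rewrite !orbT.
  exists d => // s t sI tI std.
  rewrite !gE // vyC ?gI //; last exact: gd.
  by rewrite invMg -mulgA mulKg.
- by rewrite g0 vy0 mulg1.
Qed.

(* The cocycle jumps by [h x] across the midpoint of circle [x]. *)
Lemma cocycle_with_holonomy (G : finGroupType) (h : bool -> G) :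
  exists c : R2 -> R2 -> G, cocycle W2 c /\ holonomy c h.
Proof.
have [par parP] := W2_param_fun.
(* The cocycle is nontrivial only in the middle half of a circle, away from the wedge point, where
   [par] is ambiguous. *)
pose mid (s : RR) := 1 / 4 < s < 3 / 4.
pose jump (x : bool) (s : RR) := if s <= 1 / 2 then 1%g else h x.
pose l p := jump (par p).1 (par p).2; pose M p := mid (par p).2.
pose c p q := (if M p && M q then (l p)^-1 * l q else 1)%g.
(* A point outside the middle half is at distance at least [1 / 4] from [1 / 2], so a point within
   [1 / 8] of it lies on the same side of the jump. *)
have jump_eq x s t : `|s - t| < 1 / 8 -> ~~ (mid s && mid t) ->
    0 <= s <= 1 -> 0 <= t <= 1 -> jump x s = jump x t.
  rewrite ltr_norml /mid /jump => /andP[? ?] + /andP[? ?] /andP[? ?].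
  case: (leP s (1 / 2)) => s2; case: (leP t (1 / 2)) => t2 //.
    by move=> /negP[]; apply/andP; split; apply/andP; lra.
  by move=> /negP[]; apply/andP; split; apply/andP; lra.
have e8 : 0 < 1 / 8 :> RR by lra.
have [d d0 dP] := wedge_close e8.
have near_mid s : near_ends (1 / 8) s -> mid s = false.
  by rewrite /mid => -[] ?; apply/negP => /andP[? ?]; lra.
(* This settles the triples with points both inside and outside the middle halves. *)
have lM p q : W2 p -> W2 q -> ball p d q -> M p || M q -> ~~ (M p && M q) -> l p = l q.
  move=> /parP[pI pE] /parP[qI qE]; rewrite {1}pE {1}qE => /(dP _ _ _ _ pI qI).
  rewrite /M /l => -[[<- b] _ n|[/near_mid -> /near_mid ->] //].
  exact: jump_eq.
exists c; split.
  exists d => // p q r Wp Wq Wr pq qr pr.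
  have := lM _ _ Wp Wq pq; have := lM _ _ Wq Wr qr; have := lM _ _ Wp Wr pr.
  rewrite /c; case: (M p); case: (M q); case: (M r) => /= A B C.
  - by rewrite mulgA mulgK.
  - by rewrite mulg1 A // B // mulVg.
  - by rewrite mulg1 C // B // mulVg.
  - by rewrite mulg1.
  - by rewrite mul1g -C // A // mulVg.
  - by rewrite mulg1.
  - by rewrite mulg1.
  - by rewrite mulg1.
move=> x; exists (jump x); split.
- by rewrite /jump; case: ifP => // /negP[]; lra.
- by rewrite /jump; case: ifP => // ?; exfalso; lra.
exists (1 / 8) => // s t sI tI st.
have parE z : 0 <= z <= 1 -> M (e x z) = mid z /\ (mid z -> l (e x z) = jump x z).
  move=> zI; have [pI /esym pE] := parP _ (W2_e x z).
  rewrite /M /l; have [[-> ->] //|[H1 H2]] := e_inj pI zI pE.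
  have mends a : at_ends a -> mid a = false.
    by rewrite /mid => -[] ->; apply/negP => /andP[? ?]; lra.
  by rewrite !mends.
have [Ms ls] := parE s sI; have [Mt lt] := parE t tI.
rewrite /c Ms Mt; case: ifP => [/andP[ms mt]|/negbT n]; first by rewrite ls // lt.
by rewrite (jump_eq x s t) // mulVg.
Qed.

(** * Inverse limits *)

Section Expansion.
Variables (T : pseudoMetricType RR) (phi : RR -> T -> T) (fs : nat -> R2 -> R2)
  (p : nat -> T -> R2).
Hypotheses (hT : hausdorff_space T) (cT : compact [set: T]) (ep : expansion phi fs p).

Lemma expansion_step n x : p n x = fs n (p n.+1 x).
Proof. by have [_ _ + _] := ep => /(_ n n.+1 (leqnSn n) x); rewrite subSnn. Qed.

Lemma expansion_W2 n x : W2 (p n x).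
Proof. by have [_ + _ _] := ep => /(_ n)[_ <- _]; exists x. Qed.

Lemma expansion_onto n P : W2 P -> exists x, p n x = P.
Proof. by have [_ + _ _] := ep => /(_ n)[_ <- _] [x _ <-]; exists x. Qed.

Lemma expansion_cont n : continuous (p n).
Proof. by have [_ + _ _] := ep => /(_ n)[]. Qed.

Lemma expansion_inj x x' : (forall n, p n x = p n x') -> x = x'.
Proof.
have [_ _ _ [psi [_ _ psiK _ _]]] := ep => xx'.
by rewrite -(psiK x) -(psiK x'); congr psi; apply/funext.
Qed.

Lemma expansion_mono n m x x' : (n <= m)%N -> p m x = p m x' -> p n x = p n x'.
Proof.
move=> /subnK <-; elim: (m - n)%N => // k IH H; apply: IH.
by rewrite (expansion_step _ x) (expansion_step _ x') -addSn H.
Qed.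

Lemma expansion_unif_cont n : @unif_cont T R2 setT (p n).
Proof.
move=> eps eps0.
by apply: uniform_cont_on => //; apply: continuous_cont_on; exact: expansion_cont.
Qed.

Lemma bonding_W2 n P : W2 P -> W2 (fs n P).
Proof. by move=> /(expansion_onto n.+1)[x <-]; rewrite -expansion_step; exact: expansion_W2. Qed.

(** Read off from the projections: [p n] is constant on the fibres of [p n.+1], which maps onto
    [W2]. *)
Lemma bonding_unif_cont n : @unif_cont R2 R2 W2 (fs n).
Proof.
move=> eps eps0; have e2 : 0 < eps / 2 by rewrite divr_gt0.
have pc m : @cont_on T R2 setT (p m) by apply: continuous_cont_on; exact: expansion_cont.
have [|d d0 H] := uniform_fibres (e := eps / 2) cT (pc n.+1) (pc n) hausdorff_R2 e2.
  by move=> x x' _ _ H; rewrite (expansion_step _ x) H -expansion_step; exact: ballxx.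
exists d => // P Q /(expansion_onto n.+1)[x <-] /(expansion_onto n.+1)[y <-] b.
by rewrite -!expansion_step (splitr eps); exact: H.
Qed.

(** Pairs at distance at least [eps] with equal projections to ever later stages would cluster at a
    pair with all projections equal, hence at a single point. *)
Lemma expansion_small_fibres eps : 0 < eps ->
  exists m0, forall x x', p m0 x = p m0 x' -> ball x eps x'.
Proof.
move=> eps0; apply: contrapT => H.
pose B n x x' := p n x = p n x' /\ ~ ball x eps x'.
have Bdec n x x' : B n.+1 x x' -> B n x x'.
  by move=> [b1 b2]; split=> //; exact: expansion_mono b1.
have Bne n : exists x x', [/\ [set: T] x, [set: T] x' & B n x x'].
  apply: contrapT => Hn; apply: H; exists n => x x' xx'; apply: contrapT => nb.
  by apply: Hn; exists x, x'.
have [x [x' [_ _ cl]]] := cluster_pair cT cT Bdec Bne.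
have xx' : x = x'.
  apply: expansion_inj => n; apply: ball_eq; first exact: hausdorff_R2.
  move=> eta eta0; have e2 : 0 < eta / 2 by rewrite divr_gt0.
  have nb z : nbhs z (p n @^-1` ball (p n z) (eta / 2)).
    by apply: (@expansion_cont n z); exact: nbhsx_ballx.
  have [y [y' [_ _ b b' [pyy' _]]]] := cl n _ _ (nb x) (nb x').
  rewrite (splitr eta); apply: ball_triangle b _.
  by rewrite /= pyy'; exact: ball_sym.
have e2 : 0 < eps / 2 by rewrite divr_gt0.
have [y [y' [_ _ b b' [_]]]] := cl 0%N _ _ (nbhsx_ballx x _ e2) (nbhsx_ballx x' _ e2).
apply; rewrite (splitr eps); apply: ball_triangle (ball_sym b) _.
by rewrite xx'.
Qed.

Lemma expansion_separation eps : 0 < eps -> exists m0, forall m, (m0 <= m)%N ->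
  exists2 d, 0 < d & forall x x', ball (p m x) d (p m x') -> ball x eps x'.
Proof.
move=> eps0; have e2 : 0 < eps / 2 by rewrite divr_gt0.
have [m0 H] := expansion_small_fibres e2; exists m0 => m mm0.
have pc : @cont_on T R2 setT (p m) by apply: continuous_cont_on; exact: expansion_cont.
have ic : @cont_on T T setT idfun by apply: continuous_cont_on => x; exact: cvg_id.
have [|d d0 dP] := uniform_fibres (e := eps / 2) cT pc ic hausdorff_R2 e2.
  by move=> x x' _ _ /(expansion_mono mm0); exact: H.
by exists d => // x x' b; rewrite (splitr eps); exact: dP.
Qed.

(** A choice of one point per fibre, in general discontinuous, which suffices because cocycles are
    arbitrary functions. *)
Lemma expansion_section m : exists s : R2 -> T, forall P, W2 P -> p m (s P) = P.
Proof.
have [x0 _] := expansion_onto 0%N W2_wedge.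
have ex P : exists x, W2 P -> p m x = P.
  have [/(expansion_onto m)[x]|] := pselect (W2 P); first by exists x.
  by exists x0.
by have [s sP] := choice ex; exists s.
Qed.

Lemma cocycle_expansion_pull (G : finGroupType) n (c : R2 -> R2 -> G) :
  cocycle W2 c -> @cocycle G T setT (fun x y => c (p n x) (p n y)).
Proof.
apply: cocycle_pull; first by move=> x _; exact: expansion_W2.
exact: expansion_unif_cont.
Qed.

(** Surjectivity of the map from the direct limit: at a late stage [c] is sampled at one point per
    fibre, and [u] compares [x] with the chosen point of its fibre, which is close to [x]. *)
Lemma cocycle_descends (G : finGroupType) (c : T -> T -> G) : cocycle setT c ->
  exists m0, forall m, (m0 <= m)%N -> exists c' u, cocycle W2 c' /\
    @cohomologous G T setT (fun x y => c' (p m x) (p m y)) c u.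
Proof.
move=> cc; have [d d0 cd] := cc; have [m0 H] := expansion_separation d0; exists m0 => m /H[d' d'0 sep].
have [s sP] := expansion_section m.
exists (fun P Q => c (s P) (s Q)), (fun x => c (s (p m x)) x); split.
  exists d' => // P Q R WP WQ WR b1 b2 b3.
  by apply: cd => //; apply: sep; rewrite !sP.
have [d2 d20 H2] := expansion_unif_cont m d'0.
exists (Num.min d d2); first by rewrite lt_min d0.
move=> x y _ _ b.
have b1 : ball x d y by apply: le_ball b; rewrite ge_min lexx.
have b2 : ball (p m x) d' (p m y) by apply: H2 => //; apply: le_ball b; rewrite ge_min lexx orbT.
have sp z : p m (s (p m z)) = p m z by apply: sP; exact: expansion_W2.
have s1 : ball (s (p m x)) d x by apply: sep; rewrite sp; exact: ballxx.
have s2 : ball (s (p m y)) d y by apply: sep; rewrite sp; exact: ballxx.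
have s3 : ball (s (p m x)) d (s (p m y)) by apply: sep; rewrite !sp.
have s4 : ball (s (p m x)) d y by apply: sep; rewrite sp.
(* After this multiplication both sides equal [c (s (p m x)) y]. *)
apply: (mulgI (c (s (p m x)) x)).
by rewrite -mulgA mulKVg (cd _ x y) // (cd _ (s (p m y)) y).
Qed.

Variable ws : nat -> bool -> seq bool.
Hypothesis rw : forall i, realizes (ws i) (fs i).

Lemma cocycle_next_stage (G : finGroupType) n (c : R2 -> R2 -> G) h :
  cocycle W2 c -> holonomy c h -> exists c', [/\ cocycle W2 c',
    holonomy c' (fun x => word_prod h (ws n x)) &
    forall x y, c' (p n.+1 x) (p n.+1 y) = c (p n x) (p n y)].
Proof.
move=> cc ch; exists (fun P Q => c (fs n P) (fs n Q)); split.
- by apply: cocycle_pull cc; [exact: bonding_W2 | exact: bonding_unif_cont].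
- by apply: holonomy_pull => //; [exact: bonding_W2 | exact: bonding_unif_cont].
- by move=> x y; rewrite -!expansion_step.
Qed.

(** The homomorphism [h] precomposed with the first [k] substitutions, the one of stage [k.-1]
    acting first on letters. *)
Fixpoint push_holonomy (G : finGroupType) (h : bool -> G) (k : nat) : bool -> G :=
  if k is k'.+1 then fun x => word_prod (push_holonomy h k') (ws k' x) else h.

Lemma cocycle_later_stage (G : finGroupType) k (c : R2 -> R2 -> G) h :
  cocycle W2 c -> holonomy c h -> exists c', [/\ cocycle W2 c',
    holonomy c' (push_holonomy h k) &
    forall x y, c' (p k x) (p k y) = c (p 0%N x) (p 0%N y)].
Proof.
move=> cc ch; elim: k => [|k [c1 [cc1 ch1 E1]]]; first by exists c.
have [c2 [cc2 ch2 E2]] := cocycle_next_stage k cc1 ch1.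
by exists c2; split=> // x y; rewrite E2.
Qed.

(** The same [g] occurs on both sides, so the property follows from injectivity on homomorphisms and
    iterates along the stages. *)
Definition conj_injective (G : finGroupType) (w : bool -> seq bool) :=
  forall (h h' : bool -> G) g, (forall x, word_prod h' (w x) = word_prod h (w x) ^ g)%g ->
    forall x, (h' x = h x ^ g)%g.

(** Injectivity of the map from stage 0 to the limit: a cohomology on [T] descends to some stage
    [m], where the holonomies become conjugate, and the substitutions are then peeled off one by
    one. *)
Lemma holonomy_conj_of_cohomologous (G : finGroupType) (c c' : R2 -> R2 -> G) h h' u :
  (forall i, conj_injective G (ws i)) ->
  cocycle W2 c -> cocycle W2 c' -> holonomy c h -> holonomy c' h' ->
  @cohomologous G T setT (fun x y => c (p 0%N x) (p 0%N y))
    (fun x y => c' (p 0%N x) (p 0%N y)) u ->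
  exists g, forall x, (h' x = h x ^ g)%g.
Proof.
move=> winj cc cc' ch ch' [d d0 cu].
have [m /(_ m (leqnn _))[d' d'0 sep]] := expansion_separation d0.
have [cm [_ chm E]] := cocycle_later_stage m cc ch.
have [cm' [_ chm' E']] := cocycle_later_stage m cc' ch'.
have [s sP] := expansion_section m.
have co : cohomologous W2 cm cm' (u \o s).
  exists d' => // P Q WP WQ b; rewrite -{1}(sP P) // -{1}(sP Q) // E'.
  rewrite cu //; last by apply: sep; rewrite !sP.
  by rewrite -E !sP.
have := holonomy_cohomologous chm chm' co; set g := (u \o s) _ => gE.
exists g; elim: (m) gE => // k IH /= H; apply: IH.
exact: (winj k).
Qed.

End Expansion.

Lemma cohomologous_sym (G : finGroupType) (M : pseudoMetricType RR) (K : set M)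
    (c c' : M -> M -> G) u :
  cohomologous K c c' u -> cohomologous K c' c (fun x => (u x)^-1)%g.
Proof.
move=> [d d0 H]; exists d => // x y Kx Ky b; rewrite H // invgK.
by rewrite -!mulgA mulgV mulg1 mulKVg.
Qed.

Lemma cohomologous_trans (G : finGroupType) (M : pseudoMetricType RR) (K : set M)
    (c c' c'' : M -> M -> G) u v :
  cohomologous K c c' u -> cohomologous K c' c'' v ->
  cohomologous K c c'' (fun x => u x * v x)%g.
Proof.
move=> [d d0 H] [d' d'0 H']; exists (Num.min d d'); first by rewrite lt_min d0.
move=> x y Kx Ky b; rewrite H' ?H //; first by rewrite invMg !mulgA.
  by apply: le_ball b; rewrite ge_min lexx.
by apply: le_ball b; rewrite ge_min lexx orbT.
Qed.

(** * The substitutions on homomorphisms *)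

Lemma word_prod_conj (G : finGroupType) (h : bool -> G) g w :
  (word_prod h w ^ g = word_prod (fun x => h x ^ g) w)%g.
Proof.
rewrite /word_prod; elim: w => [|x w IH]; first by rewrite !big_nil conj1g.
by rewrite !big_cons conjMg IH.
Qed.

Lemma conj_injective_of_injective (G : finGroupType) (w : bool -> seq bool) :
  (forall h h' : bool -> G, (forall x, word_prod h (w x) = word_prod h' (w x)) ->
     h =1 h') -> conj_injective G w.
Proof. by move=> H h h' g E x; rewrite (H h' (fun y => h y ^ g)%g) // => y; rewrite E word_prod_conj. Qed.

(** The inverse automorphism by cancellation: the image of [a] is [aab] followed by that of [b],
    which gives [aab]; the image of [b] is [aab] followed by [ab], which gives [ab], then [a] and
    [b]. *)
Lemma sigma_conj_injective (G : finGroupType) : conj_injective G sigma_w.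
Proof.
apply: conj_injective_of_injective => h h' E.
have /esym E1 := E true; have /esym E2 := E false; move: E1 E2.
rewrite /word_prod /sigma_w !big_cons !big_nil !mulg1 /ltr_a /ltr_b.
set A := h true; set B := h false; set A' := h' true; set B' := h' false => E1 E2.
have D : (A * (A * B) = A' * (A' * B'))%g.
  apply: (@mulIg _ (A * (A * (B * (A * B))))%g); rewrite -{2}E2 -!mulgA; exact/esym.
have F : (A * B = A' * B')%g.
  by apply: (@mulgI _ (A * (A * B))%g); rewrite {2}D -!mulgA; exact/esym.
have AA : A = A' by apply: (@mulIg _ (A * B)%g); rewrite {2}F.
have BB : B = B' by apply: (@mulgI _ A); rewrite {2}AA.
by case.
Qed.

(** The image of [b] is [b] followed by that of [a], which gives [b], and then [ba] gives [a]. *)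
Lemma rho_conj_injective (G : finGroupType) : conj_injective G rho_w.
Proof.
apply: conj_injective_of_injective => h h' E.
have := E false; have := E true.
rewrite /word_prod /rho_w !big_cons !big_nil !mulg1 /ltr_a /ltr_b => E1 E2.
have BB : h false = h' false.
  by apply: (mulIg (h false * h true)%g); rewrite {2}E1.
by case=> //; apply: (mulgI (h false)); rewrite {2}BB.
Qed.

(* With [r = (0 1)] and [s = (1 2)], [tau] sends both [(r, r s)] and [(r s r, 1)] to
   [(r s r, r s r)]. *)
Lemma tau_not_conj_injective : exists a b : bool -> {perm 'I_3},
  (forall x, word_prod a (tau_w x) = word_prod b (tau_w x)) /\
  ~ exists g, forall x, (b x = a x ^ g)%g.
Proof.
pose i1 : 'I_3 := inord 1; pose i2 : 'I_3 := inord 2.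
have d01 : ord0 != i1 by rewrite -val_eqE /= inordK.
have d02 : ord0 != i2 by rewrite -val_eqE /= inordK.
have d12 : i1 != i2 by rewrite -val_eqE /= !inordK.
pose r : {perm 'I_3} := tperm ord0 i1; pose s : {perm 'I_3} := tperm i1 i2.
have rr : (r * r = 1)%g by exact: tperm2.
have ss : (s * s = 1)%g by exact: tperm2.
have rrK x : (r * (r * x) = x)%g by rewrite mulgA rr mul1g.
have ssK x : (s * (s * x) = x)%g by rewrite mulgA ss mul1g.
have braid : (r * (s * r) = s * (r * s))%g.
  have -> : (r * (s * r) = s ^ r)%g by rewrite conjgE tpermV.
  have -> : (s * (r * s) = r ^ s)%g by rewrite conjgE tpermV.
  rewrite !tpermJ /r /s tpermR tpermL tpermD // 1?eq_sym // tpermD // 1?eq_sym //.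
exists (fun x => if x then r else (r * s)%g), (fun x => if x then (r * (s * r))%g else 1%g).
split.
  (* On the second letter the two sides reduce to [s * (r * s)] and [r * (s * r)], which [braid]
     identifies. *)
  by case; rewrite /word_prod /tau_w !big_cons !big_nil /ltr_a /ltr_b !mulg1 ?mul1g -!mulgA !(rrK, ssK, rr, ss, mulg1).
(* A conjugate of 1 is 1, whereas [r * s] moves 0 to 2. *)
move=> [g /(_ false) /esym/eqP]; rewrite conjg_eq1 => /eqP/permP/(_ ord0).
by rewrite permM tpermL tpermL perm1 => /eqP; rewrite eq_sym (negbTE d02).
Qed.

(** * Counting classes, and the comparison of the two families *)

(** On chosen representatives [rep \o K] is injective, hence onto by finiteness. So [a] and [b] are
    equivalent to [K x] and [K y] with [x], [y] representatives, and [R x y] forces [x = y]. *)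
Lemma equiv_class_injection (T : finType) (R : rel T) (K : T -> T) :
  equivalence_rel R -> (forall x y, R (K x) (K y) -> R x y) ->
  forall a b, (forall x y, R (K x) a -> R (K y) b -> R x y) -> R a b.
Proof.
move=> eR Kinj a b Hab.
have Rxx x : R x x by have [? _] := eR x x x.
have Rl x y : R x y -> R x =1 R y by move=> xy z; have [_] := eR x y z; apply.
have Rs x y : R x y -> R y x by move=> xy; rewrite -(Rl _ _ xy).
pose rep x := odflt x [pick y | R x y].
have repR x : R x (rep x).
  by rewrite /rep; case: pickP => //= y.
have repE x y : R x y -> rep x = rep y.
  move=> xy; rewrite /rep (eq_pick (Rl _ _ xy)); case: pickP => //= H.
  by have := H y; rewrite Rxx.
have repI x : rep (rep x) = rep x by rewrite -(repE _ _ (repR x)).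
pose S : {set T} := (rep @: T)%SET.
have fS : ((rep \o K) @: S)%SET = S.
  apply/eqP; rewrite eqEcard; apply/andP; split.
    by apply/fintype.subsetP => _ /imsetP[x _ ->]; apply: imset_f.
  rewrite card_in_imset // => _ _ /imsetP[x _ ->] /imsetP[y _ ->] /= E.
  rewrite -(repI x) -(repI y); apply: repE; apply: Kinj.
  by rewrite (Rl _ _ (repR (K (rep x)))) E; exact/Rs/repR.
have pre z : exists x, R (K (rep x)) z.
  have : rep z \in ((rep \o K) @: S)%SET by rewrite fS imset_f.
  move=> /imsetP[_ /imsetP[x _ ->] /= E]; exists x.
  by rewrite (Rl _ _ (repR _)) -E; exact/Rs/repR.
have [x xa] := pre a; have [y yb] := pre b.
have := Hab _ _ xa yb => /repE; rewrite !repI => E.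
by rewrite -(Rl _ _ xa) E.
Qed.

Theorem theorem8p5
  (f_sigma f_tau f_rho : R2 -> R2)
  (Hsigma : realizes sigma_w f_sigma)
  (Htau : realizes tau_w f_tau)
  (Hrho : realizes rho_w f_rho)
  (T1 : pseudoMetricType RR) (phi1 : RR -> T1 -> T1)
  (T2 : pseudoMetricType RR) (phi2 : RR -> T2 -> T2) :
  flow_space phi1 -> flow_space phi2 ->
  nonconstant f_sigma f_rho phi1 -> nonconstant f_tau f_rho phi2 ->
  ~ flow_equiv phi1 phi2.
Proof.
move=> [hT1 cT1 _ _] [hT2 cT2 _ _] [s1 [[p ep] _]] [s2 [[q eq] nc]] [h [g [hc gc hK gK _]]].
pose G : finGroupType := {perm 'I_3}; pose V := {ffun bool -> G}.
pose ws1 i := if s1 i then sigma_w else rho_w.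
pose ws2 i := if s2 i then tau_w else rho_w.
have rw1 i : realizes (ws1 i) (if s1 i then f_sigma else f_rho) by rewrite /ws1; case: (s1 i).
have rw2 i : realizes (ws2 i) (if s2 i then f_tau else f_rho) by rewrite /ws2; case: (s2 i).
have inj1 i : conj_injective G (ws1 i).
  by rewrite /ws1; case: (s1 i); [exact: sigma_conj_injective | exact: rho_conj_injective].
(* Otherwise the symbols are eventually [false], that is, constantly [rho]. *)
have tau_often m0 : exists2 m, (m0 <= m)%N & s2 m = true.
  apply: contrapT => H; apply: nc; exists false, m0, 0%N => j.
  by apply/negbTE/negP => sj; apply: H; exists (m0 + j)%N => //; exact: leq_addr.
have uh : @unif_cont T1 T2 setT h.
  by move=> eps eps0; apply: uniform_cont_on => //; exact: continuous_cont_on.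
have ug : @unif_cont T2 T1 setT g.
  by move=> eps eps0; apply: uniform_cont_on => //; exact: continuous_cont_on.
(* Every homomorphism [a] from the free group to [S_3] is realized at stage 0 of the first space and
   carried to the second by [g]. *)
have exc (a : V) := cocycle_with_holonomy a.
have [c cP] := choice exc.
pose C (a : V) (y y' : T2) : G := c a (p 0%N (g y)) (p 0%N (g y')).
have CC a : cocycle setT (C a).
  have [/(cocycle_expansion_pull hT1 cT1 ep 0) cc _] := cP a.
  exact: (@cocycle_pull G T2 T1 setT setT g _ (fun _ _ => I) ug cc).
have exm a := cocycle_descends hT2 cT2 eq (CC a).
have [m0 m0P] := choice exm.
(* As [V] is finite, one stage [m] serves all [a], and it can be chosen with bonding map [tau]. *)
have [m Mm sm] := tau_often (\max_a m0 a)%N.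
(* The element [b] is the holonomy at stage [m]; one stage later it has passed through [tau]. *)
have exK a : exists b : V, exists c' u, [/\ cocycle W2 c',
    holonomy c' (fun x => word_prod b (tau_w x)) &
    @cohomologous G T2 setT (fun x y => c' (q m.+1 x) (q m.+1 y)) (C a) u].
  have am : (m0 a <= m)%N by apply: leq_trans Mm; exact: leq_bigmax.
  have [c' [u [cc' co]]] := m0P a m am.
  have [b bP] := holonomy_exists cc'.
  have [c'' [cc'' cb E]] := cocycle_next_stage cT2 eq rw2 m cc' bP.
  exists (finfun b), c'', u; split=> //.
    move: cb; rewrite /ws2 sm /holonomy => cb x; have [v [v0 v1 vC]] := cb x.
    by exists v; split=> //; rewrite v1 /word_prod; apply: eq_bigr => i _; rewrite ffunE.
  by have -> : (fun x y => c'' (q m.+1 x) (q m.+1 y)) = (fun x y => c' (q m x) (q m y))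
    by apply/funext => x; apply/funext => y.
have [K KP] := choice exK.
pose R (a b : V) := [exists k, [forall x, b x == (a x ^ k)%g]].
have RP (a b : V) : reflect (exists k, forall x, b x = (a x ^ k)%g) (R a b).
  apply: (iffP existsP) => -[k H]; exists k.
    by move=> x; apply/eqP; exact: (forallP H).
  by apply/forallP => x; rewrite H.
have eR : equivalence_rel R.
  move=> x y z; split; first by apply/RP; exists 1%g => i; rewrite conjg1.
  move=> /RP[k xy]; apply/RP/RP => -[l H].
    by exists (k^-1 * l)%g => i; rewrite H xy conjgM conjgK.
  by exists (k * l)%g => i; rewrite H xy conjgM.
(* Conjugate holonomies at stage [m.+1] make [C a] and [C b] cohomologous. Transport by [h] to the
   first space and injectivity there give [R a b]. *)
have collapse a b k :
    (forall x, word_prod (K b) (tau_w x) = (word_prod (K a) (tau_w x) ^ k)%g) -> R a b.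
  move=> E; apply/RP.
  have [ca [ua [cca ha coa]]] := KP a; have [cb [ub [ccb hb cob]]] := KP b.
  have [u cou] := cohomologous_of_conj cca ccb ha hb E.
  have [cca0 ha0] := cP a; have [ccb0 hb0] := cP b.
  have [w [d d0 cow]] : exists w, @cohomologous G T2 setT (C a) (C b) w.
    have := @cohomologous_pull _ T2 R2 setT W2 (q m.+1) _ _ _ _ _ cou.
    move=> /(_ (fun x _ => expansion_W2 eq m.+1 x) (expansion_unif_cont hT2 cT2 eq m.+1)) => coq.
    by eexists; exact: cohomologous_trans (cohomologous_sym coa) (cohomologous_trans coq cob).
  have co1 : @cohomologous G T1 setT (fun x y => c a (p 0%N x) (p 0%N y))
      (fun x y => c b (p 0%N x) (p 0%N y)) (w \o h).
    have [d' d'0 hd] := uh d d0; exists d' => // x y _ _ xy.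
    by have := cow (h x) (h y) I I (hd _ _ I I xy); rewrite /C !hK.
  have [l lP] := holonomy_conj_of_cohomologous cT1 ep rw1 inj1 cca0 ccb0 ha0 hb0 co1.
  by exists l => x; exact: lP.
have Kinj a b : R (K a) (K b) -> R a b.
  move=> /RP[k E]; apply: (collapse a b k) => x; rewrite word_prod_conj /word_prod.
  by apply: eq_bigr => i _; rewrite E.
have [t1 [t2 [t12 nt]]] := tau_not_conj_injective.
(* By counting, [K] meets the classes of [t1] and [t2]; their equal images under [tau] force the
   corresponding sources together. *)
have : R (finfun t1) (finfun t2).
  apply: (equiv_class_injection eR Kinj) => a b /RP[k ka] /RP[l lb].
  have prodK (t : bool -> G) (b' : V) i j : (forall x, (finfun t : V) x = (b' x ^ j)%g) ->
      word_prod t (tau_w i) = (word_prod b' (tau_w i) ^ j)%g.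
    move=> H; rewrite word_prod_conj /word_prod; apply: eq_bigr => x _.
    by rewrite -H ffunE.
  (* Conjugation by [k] leads from [K a] to [t1], and by [l^-1] from [t2] back to [K b]. *)
  apply: (collapse a b (k * l^-1)%g) => x.
  by rewrite conjgM -(prodK _ _ _ _ ka) t12 (prodK _ _ _ _ lb) conjgK.
move=> /RP[k H]; apply: nt; exists k => x.
by have := H x; rewrite !ffunE.
Qed.
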